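(* Consider the traveling repairman problem with unit-time windows (defined in the context). Trim all windows using the periods $[j/2,(j+1)/2)$, $j\in\mathbb{Z}$ (offset $0$), and run the algorithm REPAIR on the trimmed instance with speed $2$. The resulting service run, which travels at speed $2$, has total profit at least $\frac{1}{2\gamma}\,\mathrm{profit}(R^* )$, where $R^*$ is a maximum-profit unit-speed service run for the original (untrimmed) windows. That is, this gives a $2\gamma$-approximation, and it runs in $\Gamma(n)$ time.
   Context: Problem: an undirected graph with metric edge lengths (either a tree or a general metric graph) on $n$ nodes, and $m$ service requests; request $i$ is located at a node $v_i$, has a nonnegative profit, and has a time window $[w_i,w_i+1)$ of unit length. A service run at speed $\sigma$ is a route that may start at any node at any time (unrooted) and moves so that it covers distance at most $\sigma t$ in any time interval of length $t$; it earns the profit of request $i$ (at most once) if it is at $v_i$ at some time in the window of request $i$. $R^*$ denotes a service run at speed $1$ of maximum total profit for the untrimmed windows. Trimming with offset $h$: the time line is divided into periods $[h+j/2,\,h+(j+1)/2)$, $j\in\mathbb{Z}$; assuming no window starts on a period boundary, each unit window contains exactly one period entirely, and the trimmed window of the request is that period. REPAIR is an algorithm which, given a trimmed instance and a speed $\sigma$, returns in time $\Gamma(n)$ a speed-$\sigma$ service run whose profit with respect to the trimmed windows is at least $1/\gamma$ times the maximum profit of any speed-$\sigma$ service run with respect to the trimmed windows; here $\gamma=1$ and $\Gamma(n)=O(n^4)$ when the graph is a tree, and $\gamma=2+\epsilon$ and $\Gamma(n)=O(n^{O(1/\epsilon^2)})$ for a general metric graph. An algorithm is a $\rho$-approximation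 if its output run has profit at least $\mathrm{profit}(R^* )/\rho$. *)

(* Defs.v *)
From HB Require Import structures.
From mathcomp Require Import all_boot all_order all_algebra.
From mathcomp Require Import boolp classical_sets reals.

Set Implicit Arguments.
Unset Strict Implicit.
Unset Printing Implicit Defensive.

Import Order.TTheory GRing.Theory Num.Theory.
Local Open Scope classical_set_scope.
Local Open Scope ring_scope.

(** ** Metric graphs *)

Record graph (R : realType) := Graph {
  nodes : nat;
  adj : rel 'I_nodes;
  len : 'I_nodes -> 'I_nodes -> R }.

Section MetricGraph.
Variables (R : realType) (g : graph R).
Implicit Types u v : 'I_(nodes g).

(* Length of the walk that starts at u and then visits the nodes of p. *)
Fixpoint walk_len u (p : seq 'I_(nodes g)) : R :=
  if p is v :: p' then len u v + walk_len v p' else 0.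

Definition dist u v : R :=
  inf [set walk_len u p | p in [set p | path (@adj _ g) u p /\ last u p = v]].

(* The last clause is what makes the edge lengths "metric": no detour between
   the endpoints of an edge is shorter than the edge itself. *)
Definition metric_graph : Prop :=
  [/\ (0 < nodes g)%N,
      symmetric (@adj _ g) /\ irreflexive (@adj _ g),
      (forall u v, len u v = len v u) /\ (forall u v, adj u v -> 0 < len u v),
      forall u v, connect (@adj _ g) u v &
      forall u p, path (@adj _ g) u p -> adj u (last u p) ->
        len u (last u p) <= walk_len u p].

Definition acyclic : Prop := forall c, ucycle (@adj _ g) c -> (size c <= 2)%N.

(* A position on the graph: a node, or the interior point of the edge {u, v} at
   distance x from u.  [OnEdge u v x] and [OnEdge v u (len u v - x)] denote the
   same interior point. *)
Inductive point :=
| AtNode of 'I_(nodes g)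
| OnEdge of 'I_(nodes g) & 'I_(nodes g) & R.

Definition valid_point (p : point) : Prop :=
  if p is OnEdge u v x then adj u v /\ 0 < x < len u v else True.

(* The nodes through which one can leave a point, with their distance to it. *)
Definition exits (p : point) : seq ('I_(nodes g) * R) :=
  match p with
  | AtNode u => [:: (u, 0)]
  | OnEdge u v x => [:: (u, x); (v, len u v - x)]
  end.

(* z is the length of the direct connection of p and q inside a common edge. *)
Definition along_edge (p q : point) (z : R) : Prop :=
  match p, q with
  | OnEdge u v x, OnEdge u' v' x' =>
      [/\ u' = u, v' = v & z = `|x - x'|] \/
      [/\ u' = v, v' = u & z = `|x - (len u v - x')|]
  | _, _ => False
  end.

Definition point_dist (p q : point) : R :=
  inf [set z | along_edge p q z \/
    exists a b, [/\ a \in exits p, b \in exits q &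
                    z = a.2 + dist a.1 b.1 + b.2]].

(** ** Service runs *)

(* Only the positions at times t with run_start <= t are meaningful. *)
Record service_run := ServiceRun { run_start : R; run_pos : R -> point }.

(* As point_dist is the shortest-path distance, being sigma-Lipschitz means
   covering distance at most sigma * t in every time interval of length t. *)
Definition speed_run (sigma : R) (r : service_run) : Prop :=
  [/\ exists u, run_pos r (run_start r) = AtNode u,
      forall t, run_start r <= t -> valid_point (run_pos r t) &
      forall s t, run_start r <= s -> run_start r <= t ->
        point_dist (run_pos r s) (run_pos r t) <= sigma * `|s - t|].

(* Position at time t of the run that is at u at time a, and then successively
   at the nodes of it at the associated times: between two stops it waits, or
   crosses the edge that joins them at constant speed.  After the last stop it
   stays there. *)
Fixpoint itinerary_pos u (a : R) (it : seq ('I_(nodes g) * R)) (t : R) : point :=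
  if it is (v, b) :: it' then
    if b <= t then itinerary_pos v b it' t
    else if (u == v) || (t <= a) then AtNode u
    else OnEdge u v (len u v * (t - a) / (b - a))
  else AtNode u.

Definition itinerary_run u (a : R) (it : seq ('I_(nodes g) * R)) : service_run :=
  ServiceRun a (itinerary_pos u a it).

End MetricGraph.

Inductive graph_class := Trees | MetricGraphs.

Definition in_family (R : realType) (F : graph_class) (g : graph R) : Prop :=
  match F with
  | Trees => metric_graph g /\ acyclic g
  | MetricGraphs => metric_graph g
  end.

(** ** Instances *)

Record instance (R : realType) := Instance {
  igraph : graph R;
  nreq : nat;
  loc : 'I_nreq -> 'I_(nodes igraph);
  worth : 'I_nreq -> R;
  wstart : 'I_nreq -> R }.

Section Instances.
Variable R : realType.
Implicit Types I : instance R.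

Definition instance_of (F : graph_class) I : Prop :=
  in_family F (igraph I) /\ forall i : 'I_(nreq I), 0 <= worth i.

(* An instance stores only where windows start: windows have length 1 in an
   original instance, and length 1/2 in a trimmed one. *)
Definition window (l w : R) : set R := [set t | w <= t < w + l].

Definition served (l : R) I (r : service_run (igraph I)) (i : 'I_(nreq I)) : Prop :=
  exists t, [/\ run_start r <= t, window l (wstart i) t &
                run_pos r t = AtNode (loc i)].

Definition profit (l : R) I (r : service_run (igraph I)) : R :=
  \sum_(i < nreq I | `[< served l r i >]) worth i.

Definition unit_profit := profit 1.
Definition trimmed_profit := profit (2^-1).

Definition optimal_run (sigma : R) I (r : service_run (igraph I)) : Prop :=
  speed_run sigma r /\
  forall r' : service_run (igraph I), speed_run sigma r' ->
    unit_profit r' <= unit_profit r.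

(* The period [h + j/2, h + (j+1)/2) is window (2^-1) (period_start h j). *)
Definition period_start (h : R) (j : int) : R := h + j%:~R / 2.

Definition off_boundary (h : R) I : Prop :=
  forall (i : 'I_(nreq I)) (j : int), wstart i <> period_start h j.

(* The start of the period contained in the unit window that starts at w; it
   exists and is unique when w is not a period boundary. *)
Definition trim_start (h w : R) : R :=
  xget 0 [set p | (exists j, p = period_start h j) /\
                  window (2^-1) p `<=` window 1 w].

Definition trim (h : R) I : instance R :=
  Instance (@loc _ I) (@worth _ I) (fun i => trim_start h (wstart i)).

End Instances.

(** ** Algorithms: programs of a real random access machine *)

(* Two unbounded memories, of naturals and of reals, and unit cost operations.
   In the comments, d, i, j, k are addresses of naturals and x, y, e addresses
   of reals.  The input is read only, and can only be accessed by the [In*]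
   instructions. *)
Inductive instr :=
| Halt
| Jump of nat
| JumpILe of nat & nat & nat           (* if [i] <= [j] goto l *)
| JumpRLe of nat & nat & nat           (* if [x] <= [y] goto l *)
| IConst of nat & nat                  (* [d] := the given constant *)
| IAdd of nat & nat & nat              (* [d] := [i] + [j] *)
| ISub of nat & nat & nat              (* truncated subtraction *)
| IMul of nat & nat & nat
| ILoad of nat & nat                   (* [d] := [[i]] *)
| IStore of nat & nat                  (* [[d]] := [i] *)
| RAffine of nat & nat & rat & rat     (* [e] := a [x] + b *)
| RAdd of nat & nat & nat              (* [e] := [x] + [y] *)
| RSub of nat & nat & nat
| RMul of nat & nat & nat
| RDiv of nat & nat & nat
| RFloor of nat & nat                  (* [e] := floor [x] *)
| RLoad of nat & nat                   (* [e] := [[i]] *)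
| RStore of nat & nat                  (* [[d]] := [x] *)
| ROfI of nat & nat                    (* [e] := [i] *)
| IOfR of nat & nat                    (* [d] := floor [x], or 0 if [x] < 0 *)
| InNodes of nat                       (* [d] := number of nodes *)
| InReqs of nat                        (* [d] := number of requests *)
| InSpeed of nat                       (* [e] := speed *)
| InAdj of nat & nat & nat             (* [d] := 1 if adj [i] [j], 0 otherwise *)
| InLen of nat & nat & nat             (* [e] := len [i] [j] *)
| InLoc of nat & nat                   (* [d] := location of request [i] *)
| InWorth of nat & nat                 (* [e] := profit of request [i] *)
| InStart of nat & nat                 (* [e] := window start of request [i] *)
| Emit of nat & nat.                   (* appends the stop ([i], [x]) to the output *)

Definition program := seq instr.

Section Machine.
Variable R : realType.

Record state := State {
  pc : nat;
  imem : nat -> nat;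
  rmem : nat -> R;
  output : seq (nat * R) }.

Definition init_state : state := State 0 (fun=> 0%N) (fun=> 0) [::].

Definition upd (T : Type) (f : nat -> T) (a : nat) (v : T) : nat -> T :=
  fun b => if b == a then v else f b.

Definition goto (l : nat) (s : state) := State l (imem s) (rmem s) (output s).
Definition seti (d k : nat) (s : state) :=
  State (pc s).+1 (upd (imem s) d k) (rmem s) (output s).
Definition setr (e : nat) (z : R) (s : state) :=
  State (pc s).+1 (imem s) (upd (rmem s) e z) (output s).

(* None: the machine is stuck; reading the input at an index out of range is an
   error. *)
Definition step (sigma : R) (I : instance R) (c : instr) (s : state) : option state :=
  let im := imem s in
  let rm := rmem s in
  let node k : option 'I_(nodes (igraph I)) := insub (im k) in
  let req k : option 'I_(nreq I) := insub (im k) in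
  match c with
  | Halt => None
  | Jump l => Some (goto l s)
  | JumpILe i j l => Some (goto (if (im i <= im j)%N then l else (pc s).+1) s)
  | JumpRLe x y l => Some (goto (if rm x <= rm y then l else (pc s).+1) s)
  | IConst d k => Some (seti d k s)
  | IAdd d i j => Some (seti d (im i + im j)%N s)
  | ISub d i j => Some (seti d (im i - im j)%N s)
  | IMul d i j => Some (seti d (im i * im j)%N s)
  | ILoad d i => Some (seti d (im (im i)) s)
  | IStore d i => Some (seti (im d) (im i) s)
  | RAffine e x a b => Some (setr e (ratr a * rm x + ratr b) s)
  | RAdd e x y => Some (setr e (rm x + rm y) s)
  | RSub e x y => Some (setr e (rm x - rm y) s)
  | RMul e x y => Some (setr e (rm x * rm y) s)
  | RDiv e x y => Some (setr e (rm x / rm y) s)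
  | RFloor e x => Some (setr e (Num.floor (rm x))%:~R s)
  | RLoad e i => Some (setr e (rm (im i)) s)
  | RStore d x => Some (setr (im d) (rm x) s)
  | ROfI e i => Some (setr e (im i)%:R s)
  | IOfR d x => Some (seti d (Num.truncn (rm x)) s)
  | InNodes d => Some (seti d (nodes (igraph I)) s)
  | InReqs d => Some (seti d (nreq I) s)
  | InSpeed e => Some (setr e sigma s)
  | InAdj d i j =>
      if (node i, node j) is (Some u, Some v) then Some (seti d (adj u v) s) else None
  | InLen e i j =>
      if (node i, node j) is (Some u, Some v) then Some (setr e (len u v) s) else None
  | InLoc d i => if req i is Some q then Some (seti d (loc q) s) else None
  | InWorth e i => if req i is Some q then Some (setr e (worth q) s) else None
  | InStart e i => if req i is Some q then Some (setr e (wstart q) s) else None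
  | Emit i x => Some (State (pc s).+1 im rm (rcons (output s) (im i, rm x)))
  end.

(* The output, if P halts (properly, by Halt) after at most T instructions. *)
Fixpoint exec (P : program) (sigma : R) (I : instance R) (T : nat) (s : state)
    : option (seq (nat * R)) :=
  if T is T'.+1 then
    match onth P (pc s) with
    | None => None
    | Some Halt => Some (output s)
    | Some c => obind (exec P sigma I T') (step sigma I c s)
    end
  else None.

(* On input (sigma, I), P outputs within time T an itinerary whose run is r. *)
Definition returns (P : program) (sigma : R) (I : instance R) (T : nat)
    (r : service_run (igraph I)) : Prop :=
  exists u a it,
    exec P sigma I T init_state
      = Some [seq (nat_of_ord stop.1, stop.2) | stop <- (u, a) :: it] /\
    r = itinerary_run u a it.

(* The specification of REPAIR.  The time bound Gamma takes the number of nodes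
   and the number of requests. *)
Definition repairs (F : graph_class) (gamma : R) (Gamma : nat -> nat -> nat)
    (P : program) : Prop :=
  forall (h sigma : R) (I : instance R),
    0 < sigma -> instance_of F I -> off_boundary h I ->
    exists r : service_run (igraph (trim h I)),
      [/\ returns P sigma (Gamma (nodes (igraph I)) (nreq I)) r,
          speed_run sigma r &
          forall r' : service_run (igraph (trim h I)), speed_run sigma r' ->
            trimmed_profit r' / gamma <= trimmed_profit r].

End Machine.

(* Main.v *)
(** Each R*-visit that serves a request happens in the trimmed period of that
    request, in the previous one or in the next one.  We follow the trajectory
    of R* along a zigzag reparametrization of time with slopes 2 and -2, of
    average slope 1 and two periods per cycle.  In units of periods, the zigzag
    [zig1] visits, relative to the current period, [[-1, 1)] in one period and
    [[-1, 0)] in the next; the zigzag [zig2] visits [[0, 2)] and then [[1, 2)].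
    Over the two zigzags and the two choices of the phase, each of [[-1, 0)],
    [[0, 1)], [[1, 2)] is visited by two of the four resulting runs of speed 2,
    whatever the period.  Their trimmed profits thus add up to at least twice
    the profit of R*, and REPAIR gets at least [1 / gamma] times each of them.

    The trimmed window of a request whose window starts at [w] starts at
    [(floor (2 w) + 1) / 2], which the machine computes in three instructions. *)

Require Import Defs.
From mathcomp Require Import all_boot all_order all_algebra.
From mathcomp Require Import boolp classical_sets reals.
From mathcomp Require Import zify ring lra.
Set Implicit Arguments.
Unset Strict Implicit.

Import Order.TTheory GRing.Theory Num.Theory.
Local Open Scope ring_scope.

(** * Location of the trimmed window *)

Section TrimStart.
Variable R : realType.
Implicit Types w t : R.

(** Inclusion of period [j] in the window forces [2 * w <= j <= 2 * w + 1]; off the boundaries the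
    left bound is strict, which leaves a single integer. *)
Lemma trim_startE w : (forall j : int, w <> period_start 0 j) ->
  trim_start 0 w = (Num.floor (2 * w) + 1)%:~R / 2.
Proof.
move=> off; set k := Num.floor (2 * w).
have /andP[kle] : k%:~R <= 2 * w < (k + 1)%:~R by exact: floor_itv.
move=> ltk; rewrite intrD in ltk.
apply: xget_unique.
  split; first by exists (k + 1); rewrite /period_start add0r.
  by rewrite intrD => t; rewrite /window /= => /andP[? ?]; apply/andP; split; lra.
move=> p [[j ->]]; rewrite /period_start add0r => sub.
have /andP[wle ltw] : w <= j%:~R / 2 < w + 1.
  by apply: sub; rewrite /window /=; apply/andP; split; lra.
have jle : j%:~R <= 2 * w + 1.
  rewrite leNgt; apply/negP => ltj.
  (* A later period would contain [w + 1], which the half-open window excludes. *)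
  have /andP[_] : w <= w + 1 < w + 1 by apply: sub; rewrite /window /=; apply/andP; split; lra.
  by rewrite ltxx.
have ltj : 2 * w < j%:~R.
  rewrite lt_neqAle; apply/andP; split; last lra.
  by apply/eqP => wj; apply: (off j); rewrite /period_start; lra.
have jk : k = j - 1 by apply: floor_def; rewrite subrK intrD mulrNz; apply/andP; split; lra.
by rewrite jk subrK.
Qed.

(** These bounds also confine the unit window to the trimmed period and its two neighbours. *)
Lemma trim_startP w : (forall j : int, w <> period_start 0 j) ->
  exists j : int, [/\ trim_start 0 w = j%:~R / 2, w <= j%:~R / 2,
    j%:~R / 2 + 2^-1 <= w + 1 & w + 1 < j%:~R / 2 + 1].
Proof.
move=> off; exists (Num.floor (2 * w) + 1); rewrite trim_startE //.
have := floor_itv (2 * w); rewrite intrD => /andP[? ?].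
by split; lra.
Qed.

End TrimStart.

(** * Trimming on the fly inside a program *)

(* Instruction number k of the source program starts at address 4 k.  The three
   arithmetic instructions only overwrite the destination e of the read. *)
Definition trim_block (k : nat) (c : instr) : seq instr :=
  match c with
  | InStart e i =>
      [:: InStart e i; RAffine e e 2 0; RFloor e e; RAffine e e 2^-1 2^-1]
  | Jump l => [:: Jump (4 * l)]
  | JumpILe i j l => [:: JumpILe i j (4 * l); Jump (4 * k.+1)]
  | JumpRLe x y l => [:: JumpRLe x y (4 * l); Jump (4 * k.+1)]
  | _ => [:: c; Jump (4 * k.+1)]
  end.

(** The input is read only, so window starts are trimmed at each read. The [Halt] padding of short
    blocks is never reached from a block start. *)
Definition trim_program (P : program) : program :=
  mkseq (fun n => nth Halt (trim_block (n %/ 4) (nth Halt P (n %/ 4))) (n %% 4))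
        (4 * size P).

Lemma onth_lt_size (T : Type) (s : seq T) (n : nat) (x : T) :
  onth s n = Some x -> (n < size s)%N.
Proof. by elim: s n => [|y s IHs] [|n] //= /IHs. Qed.

Lemma nth_onth (T : Type) (x0 : T) (s : seq T) (n : nat) :
  (n < size s)%N -> onth s n = Some (nth x0 s n).
Proof. by elim: s n => [|y s IHs] [|n] //= /IHs. Qed.

Lemma onth_trim_program (P : program) (k d : nat) (c : instr) :
  onth P k = Some c -> (d < 4)%N ->
  onth (trim_program P) (d + 4 * k) = Some (nth Halt (trim_block k c) d).
Proof.
move=> Pk d4; have ltk := onth_lt_size Pk.
have ltdk : (d + 4 * k < 4 * size P)%N by lia.
rewrite (nth_onth Halt) ?size_mkseq // nth_mkseq //.
have -> : ((d + 4 * k) %/ 4 = k)%N by lia.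
have -> : ((d + 4 * k) %% 4 = d)%N by lia.
by rewrite (onth_nth _ _ _ _ Pk).
Qed.

Section Simulation.
Variables (R : realType) (sigma : R) (I : instance R).
Hypothesis off : off_boundary 0 I.
Implicit Types (P : program) (s : state R).

Lemma execS P T s c : onth P (pc s) = Some c -> c <> Halt ->
  exec P sigma I T.+1 s = obind (exec P sigma I T) (step sigma I c s).
Proof. by move=> /= -> ; case: c. Qed.

Lemma exec_step P T s s' c out : onth P (pc s) = Some c -> c <> Halt ->
  step sigma I c s = Some s' -> exec P sigma I T s' = Some out ->
  exec P sigma I T.+1 s = Some out.
Proof. by move=> Pc nH st; rewrite (execS _ Pc nH) st. Qed.

Lemma exec_monotone P T T' s out : (T <= T')%N ->
  exec P sigma I T s = Some out -> exec P sigma I T' s = Some out.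
Proof.
elim: T T' s => // T IHT [//|T'] s leT.
case Pc: (onth P (pc s)) => [c|]; last by rewrite /= Pc.
have [cH|nH] : c = Halt \/ c <> Halt by case: (c); [left|right..].
  by rewrite /= Pc cH.
rewrite !(execS _ Pc) //; case: step => //= s'; exact: IHT.
Qed.

(** Each source step becomes at most four steps leading from one block start to another, with the
    same memories at both ends. *)
Lemma exec_trim_program P T s out :
  exec P sigma (trim 0 I) T s = Some out ->
  exec (trim_program P) sigma I (4 * T) (goto (4 * pc s) s) = Some out.
Proof.
elim: T s out => // T IHT s out.
case Pc: (onth P (pc s)) => [c|]; last by rewrite /= Pc.
have at_block d : (d < 4)%N ->
    onth (trim_program P) (d + 4 * pc s) = Some (nth Halt (trim_block (pc s) c) d).
  exact: onth_trim_program.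
(* What may follow the first instruction of a block: nothing ([IH1]), one [Jump] ([IH2]), or the
   three arithmetic instructions ([IH4]). *)
have IH1 s' s'' : s'' = goto (4 * pc s') s' ->
    exec P sigma (trim 0 I) T s' = Some out ->
    exec (trim_program P) sigma I (4 * T).+3 s'' = Some out.
  by move=> -> /IHT; apply: exec_monotone; lia.
have IH2 s' s'' : onth (trim_program P) (pc s'') = Some (Jump (4 * pc s')) ->
    goto (4 * pc s') s'' = goto (4 * pc s') s' ->
    exec P sigma (trim 0 I) T s' = Some out ->
    exec (trim_program P) sigma I (4 * T).+3 s'' = Some out.
  move=> Pj E /IHT; rewrite -E => H; apply: (exec_step Pj) => //.
  by apply: exec_monotone H; lia.
have IH4 e i (q : 'I_(nreq I)) : c = InStart e i ->
    exec P sigma (trim 0 I) T (setr e (trim_start 0 (wstart q)) s) = Some out ->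
    exec (trim_program P) sigma I (4 * T).+3
      (setr e (wstart q) (goto (4 * pc s) s)) = Some out.
  move=> cE /IHT H; have := at_block 3%N isT; have := at_block 2%N isT.
  have := at_block 1%N isT; rewrite cE => P1 P2 P3.
  eapply exec_step; [exact: P1|by []|reflexivity|].
  eapply exec_step; [exact: P2|by []|reflexivity|].
  eapply exec_step; [exact: P3|by []|reflexivity|].
  rewrite -H; congr exec.
  rewrite /setr /goto /=; congr State; first by lia.
  apply/funext => a; rewrite /upd; case: eqP => // _.
  rewrite eqxx trim_startE; last exact: off.
  rewrite rmorph0 addr0 (_ : ratr 2 = 2) ?ratr_nat // intrD.
  have -> : ratr 2^-1 = 2^-1 :> R by rewrite fmorphV /= ratr_nat.
  by field.
rewrite (_ : (4 * T.+1 = (4 * T).+3.+1)%N); last by lia.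
move: (4 * T).+3 IH1 IH2 IH4 => N IH1 IH2 IH4.
have := at_block 0%N isT; have := at_block 1%N isT; rewrite add0n.
case: c Pc at_block IH4 => [|l|i j l|x y l|d k|d i j|d i j|d i j|d i|d i|e x a b
  |e x y|e x y|e x y|e x y|e x|e i|d x|e i|d x|d|d|e|d i j|e i j|d i|e i|e i|i x]
  Pc at_block IH4 P1 P0; rewrite /= Pc P0 /=.
- by [].
- by apply: IH1.
- by case: ifP => _; [apply: IH1|apply: IH2].
- by case: ifP => _; [apply: IH1|apply: IH2].
all: try by apply: IH2.
all: case: insub => [u|] //=; try (case: insub => [v|] //=).
all: by [apply: IH2|apply: IH4].
Qed.

End Simulation.

(** * Zigzag reparametrizations of time *)

Section Zigzag.
Variable R : realType.
Implicit Types (g : R -> R) (b t x q : R) (m : int).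

(* The extension of g from [0, 1) such that t - zigzag g b t has period 1, that
   is, two trimming periods; b is the phase. *)
Definition zigzag g b t : R :=
  (Num.floor (t - b))%:~R + b + g (t - b - (Num.floor (t - b))%:~R).

Lemma zigzagE g b m x : 0 <= x < 1 -> zigzag g b (m%:~R + b + x) = m%:~R + b + g x.
Proof.
move=> /andP[x0 x1]; have tb : m%:~R + b + x - b = m%:~R + x by ring.
have fl : Num.floor (m%:~R + x) = m.
  by apply: floor_def; rewrite intrD; apply/andP; split; lra.
by rewrite /zigzag tb fl; congr (_ + g _); ring.
Qed.

Lemma zigzag_le g b t : (forall x, 0 <= x < 1 -> g x <= x + 1) ->
  zigzag g b t <= t + 1.
Proof.
move=> gle; have := floor_itv (t - b); rewrite intrD /zigzag.
set m := (Num.floor _)%:~R => /andP[? ?].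
have : g (t - b - m) <= t - b - m + 1 by apply: gle; apply/andP; split; lra.
lra.
Qed.

(** [g 1 = g 0 + 1] glues consecutive cycles continuously. Across cycles, compare [s] with the end
    of its cycle and [t] with the start of its own; each full cycle between advances by only 1. *)
Lemma zigzag_lipschitz g b s t :
  (forall x y, `|g x - g y| <= 2 * `|x - y|) -> g 1 = g 0 + 1 ->
  `|zigzag g b s - zigzag g b t| <= 2 * `|s - t|.
Proof.
move=> glip g1; wlog st : s t / s <= t.
  by move=> H; case: (leP s t) => [|/ltW] /H //; rewrite distrC (distrC t).
have fl : Num.floor (s - b) <= Num.floor (t - b) by apply: le_floor; lra.
have := floor_itv (s - b); have := floor_itv (t - b); rewrite /zigzag !intrD.
move: (Num.floor (s - b)) (Num.floor (t - b)) fl => m n mn /andP[? ?] /andP[? ?].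
rewrite (distrC s) (ger0_norm (_ : 0 <= t - s)); last lra.
have [->|ltmn] := eqVneq m n.
  rewrite (_ : _ - _ = g (s - b - n%:~R) - g (t - b - n%:~R)); last ring.
  apply: le_trans (glip _ _) _; rewrite distrC ger0_norm; lra.
have mn1 : m%:~R + 1 <= n%:~R :> R.
  by rewrite -[1]/(1%:~R) -intrD ler_int; lia.
have := glip (s - b - m%:~R) 1; have := glip (t - b - n%:~R) 0.
rewrite g1 subr0 (ger0_norm (_ : 0 <= t - b - n%:~R)); last lra.
rewrite (distrC _ 1) (ger0_norm (_ : 0 <= 1 - (s - b - m%:~R))); last lra.
rewrite !ler_norml => /andP[? ?] /andP[? ?]; apply/andP; split; lra.
Qed.

(** Trimming periods have length 1/2. [zig1] goes from -1/2 up to 1/2, down to 0 and up to 1/2,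
    turning at 1/2 and 3/4; [zig2] goes from 0 up to 3/2 and down to 1, turning at 3/4. *)
Definition zig1 x : R := Num.max (Num.min (2 * x - 2^-1) (3 / 2 - 2 * x)) (2 * x - 3 / 2).
Definition zig2 x : R := Num.min (2 * x) (3 - 2 * x).

Lemma zig1P x : [\/ x <= 2^-1 /\ zig1 x = 2 * x - 2^-1,
  [/\ 2^-1 <= x, x <= 3 / 4 & zig1 x = 3 / 2 - 2 * x] |
  3 / 4 <= x /\ zig1 x = 2 * x - 3 / 2].
Proof.
rewrite /zig1; case: (leP (2 * x - 2^-1) (3 / 2 - 2 * x)) => ?.
  by rewrite max_l; [apply: Or31; split|]; lra.
case: (leP (3 / 2 - 2 * x) (2 * x - 3 / 2)) => ?.
  by apply: Or33; split; lra.
by apply: Or32; split; lra.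
Qed.

Lemma zig2P x : x <= 3 / 4 /\ zig2 x = 2 * x \/ 3 / 4 <= x /\ zig2 x = 3 - 2 * x.
Proof.
by rewrite /zig2; case: (leP (2 * x) (3 - 2 * x)) => ?; [left|right]; split; lra.
Qed.

Lemma zig1_lipschitz x y : `|zig1 x - zig1 y| <= 2 * `|x - y|.
Proof.
rewrite ler_norml; case: (lerP x y) => ?;
  case: (zig1P x) => [[? ->]|[? ? ->]|[? ->]];
  case: (zig1P y) => [[? ->]|[? ? ->]|[? ->]];
  apply/andP; split; lra.
Qed.

Lemma zig2_lipschitz x y : `|zig2 x - zig2 y| <= 2 * `|x - y|.
Proof.
rewrite ler_norml; case: (lerP x y) => ?;
  case: (zig2P x) => [][? ->]; case: (zig2P y) => [][? ->];
  apply/andP; split; lra.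
Qed.

Lemma zig1_le x : 0 <= x < 1 -> zig1 x <= x + 1.
Proof. by move=> /andP[? ?]; case: (zig1P x) => [][]; lra. Qed.

Lemma zig2_le x : 0 <= x < 1 -> zig2 x <= x + 1.
Proof. by move=> /andP[? ?]; case: (zig2P x) => [][]; lra. Qed.

Definition phase (c : bool) : R := if c then 2^-1 else 0.

Definition hits g (c : bool) (p q : R) : Prop :=
  exists2 t, p <= t < p + 2^-1 & zigzag g (phase c) t = q.

Lemma hits_zigzag g c m x p q : 0 <= x < 1 ->
  p <= m%:~R + phase c + x < p + 2^-1 -> m%:~R + phase c + g x = q ->
  hits g c p q.
Proof. by move=> x01 pt gq; exists (m%:~R + phase c + x); rewrite ?zigzagE. Qed.

(** By parity of [j], period [j] is the first half of a cycle for phase [c] and the second half for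
    the other phase. *)
Lemma phase_split (j : int) : exists c m n,
  j%:~R / 2 = m%:~R + phase c /\ j%:~R / 2 = n%:~R + phase (~~ c) + 2^-1.
Proof.
have [m [->|->]] : exists m : int, j = m * 2 \/ j = m * 2 + 1.
  by exists (j %/ 2)%Z; lia.
  exists false, m, (m - 1); rewrite /phase /= ?(intrD, intrM, mulrNz) /=.
  by split; lra.
exists true, m, m; rewrite /phase /= ?(intrD, intrM) /=.
by split; lra.
Qed.

(** The cases are [q] in the previous, current or next period. [zig1] covers the previous one in
    both halves of its cycle, [zig2] the next one; both cover the current one in the first half,
    hence with a common phase. *)
Lemma hits_two (j : int) q (p := j%:~R / 2) : p - 2^-1 <= q < p + 1 ->
  [\/ hits zig1 true p q /\ hits zig1 false p q,
      exists c, hits zig1 c p q /\ hits zig2 c p q |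
      hits zig2 true p q /\ hits zig2 false p q].
Proof.
have [c [m [n []]]] := phase_split j; rewrite -/p => pm pn /andP[leq ltq].
have both (P : bool -> Prop) : P c -> P (~~ c) -> P true /\ P false.
  by case: (c).
have [qp|pq] := ltP q p.
  apply: Or31; apply: (both (fun c => hits zig1 c p q)).
    (* The offset solves [2 * x - 2^-1 = q - p] on the first rising branch; later offsets likewise
       invert a linear branch. *)
    apply: (@hits_zigzag _ _ m ((q - p + 2^-1) / 2)); first (apply/andP; split; lra).
      by apply/andP; split; lra.
    by case: (zig1P ((q - p + 2^-1) / 2)) => [][]; lra.
  (* In the second half the target is [q - p + 2^-1], reached on the falling branch. *)
  apply: (@hits_zigzag _ _ n (3 / 4 - (q - p + 2^-1) / 2)); first (apply/andP; split; lra).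
    by apply/andP; split; lra.
  by case: (zig1P (3 / 4 - (q - p + 2^-1) / 2)) => [][]; lra.
have [qp|pq'] := ltP q (p + 2^-1).
  apply: Or32; exists c; split.
    apply: (@hits_zigzag _ _ m ((q - p + 2^-1) / 2)); first (apply/andP; split; lra).
      by apply/andP; split; lra.
    by case: (zig1P ((q - p + 2^-1) / 2)) => [][]; lra.
  apply: (@hits_zigzag _ _ m ((q - p) / 2)); first (apply/andP; split; lra).
    by apply/andP; split; lra.
  by case: (zig2P ((q - p) / 2)) => [][]; lra.
apply: Or33; apply: (both (fun c => hits zig2 c p q)).
  apply: (@hits_zigzag _ _ m ((q - p) / 2)); first (apply/andP; split; lra).
    by apply/andP; split; lra.
  by case: (zig2P ((q - p) / 2)) => [][]; lra.
apply: (@hits_zigzag _ _ n ((q - p + 2^-1) / 2)); first (apply/andP; split; lra).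
  by apply/andP; split; lra.
by case: (zig2P ((q - p + 2^-1) / 2)) => [][]; lra.
Qed.

End Zigzag.

(** * Zigzag runs and their profits *)

Section Runs.
Variable R : realType.

(* R* has no meaningful position before its start: wait at its first node.  It
   suffices to start one unit earlier when tau t <= t + 1. *)
Definition reparametrized_run (g : graph R) (r : service_run g) (tau : R -> R) :
    service_run g :=
  ServiceRun (run_start r - 1) (fun t => run_pos r (Num.max (run_start r) (tau t))).

Lemma reparametrized_run_speed (g : graph R) (r : service_run g) (tau : R -> R) (k : R) :
  speed_run 1 r -> (forall t, tau t <= t + 1) ->
  (forall s t, `|tau s - tau t| <= k * `|s - t|) ->
  speed_run k (reparametrized_run r tau).
Proof.
move=> [[u start_u] valid lip] tau_le tau_lip; split=> /=.
- by exists u; rewrite max_l //; have := tau_le (run_start r - 1); rewrite subrK.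
- by move=> t _; apply: valid; rewrite le_max lexx.
move=> s t _ _; apply: le_trans (lip _ _ _ _) _; rewrite ?le_max ?lexx // mul1r.
apply: le_trans (tau_lip s t).
(* Clamping [tau] from below at the start of [r] does not increase distances. *)
case: (leP _ (tau s)) => ?; case: (leP _ (tau t)) => ?; rewrite ?subrr ?normr0 //.
- by rewrite ger0_norm ?ger0_norm; lra.
- by rewrite ler0_norm ?ler0_norm; lra.
Qed.

Definition zigzag_run (g : graph R) (r : service_run g) (z : R -> R) (c : bool) :=
  reparametrized_run r (zigzag z (phase R c)).

Lemma zig1_run_speed (g : graph R) (r : service_run g) c :
  speed_run 1 r -> speed_run 2 (zigzag_run r (@zig1 R) c).
Proof.
move=> sr; apply: reparametrized_run_speed => // [t|s t].
  by apply: zigzag_le; exact: zig1_le.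
apply: zigzag_lipschitz; first exact: zig1_lipschitz.
by case: (zig1P (1 : R)) => [][]; case: (zig1P (0 : R)) => [][]; lra.
Qed.

Lemma zig2_run_speed (g : graph R) (r : service_run g) c :
  speed_run 1 r -> speed_run 2 (zigzag_run r (@zig2 R) c).
Proof.
move=> sr; apply: reparametrized_run_speed => // [t|s t].
  by apply: zigzag_le; exact: zig2_le.
apply: zigzag_lipschitz; first exact: zig2_lipschitz.
by case: (zig2P (1 : R)) => [][]; case: (zig2P (0 : R)) => [][]; lra.
Qed.

Variable I : instance R.
Hypothesis off : off_boundary 0 I.
Implicit Types r : service_run (igraph I).

Lemma served_trim r i :
  served (2^-1) (I := trim 0 I) r i -> served 1 (I := I) r i.
Proof.
move=> [t [rt wt pt]]; exists t; split=> //; move: wt; rewrite /window /=.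
have [j [-> ? ? _]] := trim_startP (@off i).
by move=> /andP[? ?]; apply/andP; split; lra.
Qed.

Lemma unit_profit_ge_trimmed r : (forall i : 'I_(nreq I), 0 <= worth i) ->
  trimmed_profit (I := trim 0 I) r <= unit_profit (I := I) r.
Proof.
move=> w0; rewrite /trimmed_profit /unit_profit /profit /=.
rewrite [leLHS]big_mkcond [leRHS]big_mkcond; apply: ler_sum => i _.
case: asboolP => [/served_trim s|_]; first by rewrite asboolT.
by case: ifP => _; rewrite ?w0.
Qed.

Lemma zigzag_run_served r (z : R -> R) c (j : int) (i : 'I_(nreq I)) t :
  (forall x, 0 <= x < 1 -> z x <= x + 1) ->
  trim_start 0 (wstart i) = j%:~R / 2 ->
  run_start r <= t -> run_pos r t = AtNode (loc i) ->
  hits z c (j%:~R / 2) t ->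
  served (2^-1) (I := trim 0 I) (zigzag_run r z c) i.
Proof.
move=> zle pj rt posr [u pu zu]; exists u; split.
(* As [run_start r <= t <= u + 1], time [u] is not before the advanced start. *)
- have := zigzag_le (phase R c) u zle; rewrite zu /=; lra.
- by rewrite /window /= pj.
- by rewrite /= zu max_r.
Qed.

Lemma served_twice r (i : 'I_(nreq I)) : served 1 (I := I) r i ->
  (2 <= \sum_(c : bool)
          (`[< served (2^-1) (I := trim 0 I) (zigzag_run r (@zig1 R) c) i >] +
           `[< served (2^-1) (I := trim 0 I) (zigzag_run r (@zig2 R) c) i >]))%N.
Proof.
move=> [t [rt]]; rewrite /window /= => /andP[? ?] posr.
have [j [pj ? ? ?]] := trim_startP (@off i).
have S1 c := zigzag_run_served (c := c) (@zig1_le R) pj rt posr.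
have S2 c := zigzag_run_served (c := c) (@zig2_le R) pj rt posr.
have : j%:~R / 2 - 2^-1 <= t < j%:~R / 2 + 1 by apply/andP; split; lra.
move=> /hits_two [[/S1 a /S1 b]|[c [/S1 a /S2 b]]|[/S2 a /S2 b]].
all: rewrite big_bool /=.
- by rewrite (asboolT a) (asboolT b); lia.
- by case: c a b => a b; rewrite (asboolT a) (asboolT b); lia.
- by rewrite (asboolT a) (asboolT b); lia.
Qed.

(** Summing request by request, [served_twice] counts each request served by [r] at least twice;
    nonnegative worths make any surplus harmless. *)
Lemma unit_profit_le_zigzag r : (forall i : 'I_(nreq I), 0 <= worth i) ->
  2 * unit_profit (I := I) r <=
    \sum_(c : bool) (trimmed_profit (I := trim 0 I) (zigzag_run r (@zig1 R) c) +
                     trimmed_profit (I := trim 0 I) (zigzag_run r (@zig2 R) c)).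
Proof.
move=> w0; rewrite big_bool /unit_profit /trimmed_profit /profit /=.
rewrite !(big_mkcond (fun i => `[< _ >])) -!big_split mulr_sumr /=.
apply: ler_sum => i _; have wi := w0 i.
case: asboolP => [/served_twice|_]; last by rewrite mulr0; repeat case: ifP => _; lra.
by rewrite big_bool /=; repeat case: asboolP => _ //; lra.
Qed.

End Runs.

Theorem theorem1 (R : realType) (F : graph_class) (gamma : R)
    (Gamma : nat -> nat -> nat) (REPAIR : program)
    (hgamma : 1 <= gamma) (hREPAIR : repairs F gamma Gamma REPAIR) :
  exists (ALG : program) (c : nat),
    forall I : instance R, instance_of F I -> off_boundary 0 I ->
    exists r : service_run (igraph I),
      [/\ returns (I := trim 0 I) REPAIR 2 (Gamma (nodes (igraph I)) (nreq I)) r,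
          returns ALG 2 (c * Gamma (nodes (igraph I)) (nreq I))%N r,
          speed_run 2 r &
          forall Rstar : service_run (igraph I), optimal_run 1 Rstar ->
            unit_profit Rstar / (2 * gamma) <= trimmed_profit (I := trim 0 I) r /\
            unit_profit Rstar / (2 * gamma) <= unit_profit r].
Proof.
exists (trim_program REPAIR), 4%N => I FI off.
have two_gt0 : 0 < 2 :> R by rewrite ltr0n.
have [r [ret sr best]] := hREPAIR 0 2 I two_gt0 FI off; exists r.
have w0 := FI.2; split=> //.
  have [u [a [it [ex ->]]]] := ret; exists u, a, it; split=> //.
  exact: (exec_trim_program off ex).
move=> Rstar [sR _].
suff half : unit_profit Rstar / (2 * gamma) <= trimmed_profit (I := trim 0 I) r.
  by split=> //; apply: le_trans half (unit_profit_ge_trimmed off r w0).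
have gamma0 : 0 < gamma by lra.
(* REPAIR competes with all four zigzag runs; adding up gives [2 * unit_profit Rstar <= 4 * gamma *
   trimmed_profit r]. *)
have B1 c := best _ (zig1_run_speed c sR).
have B2 c := best _ (zig2_run_speed c sR).
move: (B1 true) (B1 false) (B2 true) (B2 false); rewrite !ler_pdivrMr ?mulr_gt0 //.
have := unit_profit_le_zigzag off Rstar w0; rewrite big_bool /=.
lra.
Qed.
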